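(* Let $G=(V,E)$ be a connected undirected graph whose nodes carry privacy labels, let $C^*=(V^*,E^* )$ be its largest public-cluster, and let $(x_k)_{k\ge 1}$ be the sequence of indices of the nodes sampled by the designed random walk, whose seed $v_{x_1}$ is in $V^*$. Let $\boldsymbol{\pi}_r=(\Pr[x_r=i])_{v_i\in V}$. Then $\boldsymbol{\pi}_r$ converges to the vector $\boldsymbol{\pi}=(p_i\,\mathbf 1_{V^*}(v_i))_{v_i\in V}$ after many steps of the designed random walk, where $p_i=\frac{d_i^*}{D^*}$.
   Context: $G=(V,E)$, $V=\{v_1,\dots,v_n\}$, is a connected undirected graph. Each node $v_i$ has a privacy label, public or private. The public-clusters are the connected components of the subgraph of $G$ formed by the public nodes; $C^*=(V^*,E^* )$ denotes the largest public-cluster. For $v_i\in V^*$, the public-degree is $d_i^*=|\{v_j\in V^*: (v_i,v_j)\in E^*\}|$, and $D^*=\sum_{v_i\in V^*}d_i^*$. $\mathbf 1_{V^*}(v_i)$ is $1$ if $v_i\in V^*$ and $0$ otherwise; $p_i\mathbf 1_{V^*}(v_i)$ is read as $0$ when $v_i\notin V^*$. Designed random walk: the first sample is a seed $v_{x_1}\in V^*$. Given the $k$-th sample $v_{x_k}$, a neighbor $u$ of $v_{x_k}$ in $G$ is selected uniformly at random; if $u$ is public, then $v_{x_{k+1}}=u$; otherwise a neighbor of $v_{x_k}$ is randomly reselected, until a public neighbor is obtained.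
   Formalization: The formal theorem assumes in addition that the largest public-cluster C* is not bipartite; otherwise the law of the walk from a given seed alternates between the two colour classes (e.g. C* a single edge), or D* = 0 when C* is a single node. *)

(* Defs.v *)
From mathcomp Require Import all_boot all_order all_algebra.
From mathcomp Require Import all_classical all_reals all_analysis.

Set Implicit Arguments.
Unset Strict Implicit.
Unset Printing Implicit Defensive.

Import Order.TTheory GRing.Theory Num.Theory.
Import numFieldNormedType.Exports.

Local Open Scope classical_set_scope.
Local Open Scope ring_scope.

(* The undirected graph G has vertex set 'I_n and symmetric edge relation e.
   Loops are not excluded; simple graphs are the case where e is irreflexive. *)

Definition is_connected_graph (n : nat) (e : rel 'I_n) : Prop :=
  forall i j : 'I_n, connect e i j.

Definition neighbors (n : nat) (e : rel 'I_n) (i : 'I_n) : {set 'I_n} :=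
  [set j | e i j]%SET.

Definition induced_edge (n : nat) (e : rel 'I_n) (S : {set 'I_n}) : rel 'I_n :=
  [rel i j | [&& i \in S, j \in S & e i j]].

Definition public_clusters (n : nat) (e : rel 'I_n) (pub : {set 'I_n}) :
    {set {set 'I_n}} :=
  [set [set j | connect (induced_edge e pub) i j] | i in pub]%SET.

(* When several public-clusters have maximal size, any one of them may play
   the role of V*. *)
Definition largest_public_cluster (n : nat) (e : rel 'I_n)
    (pub Vs : {set 'I_n}) : Prop :=
  Vs \in public_clusters e pub /\
  forall C : {set 'I_n}, C \in public_clusters e pub -> (#|C| <= #|Vs|)%N.

Definition public_degree (n : nat) (e : rel 'I_n) (Vs : {set 'I_n})
    (i : 'I_n) : nat :=
  #|[set j in Vs | induced_edge e Vs i j]%SET|.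

Definition total_public_degree (n : nat) (e : rel 'I_n)
    (Vs : {set 'I_n}) : nat :=
  (\sum_(i in Vs) public_degree e Vs i)%N.

(* On a bipartite public-cluster the walk is periodic and its law may alternate
   forever between the two colour classes.  A cluster reduced to one loopless
   node is bipartite as well. *)
Definition bipartite_on (n : nat) (e : rel 'I_n) (Vs : {set 'I_n}) : Prop :=
  exists c : 'I_n -> bool,
    forall i j : 'I_n, induced_edge e Vs i j -> c i != c j.

Definition uniform_neighbor (R : realType) (n : nat) (e : rel 'I_n)
    (i j : 'I_n) : R :=
  (j \in neighbors e i)%:R / #|neighbors e i|%:R.

(* X k is the index of the (k+1)-th sample, so X 0 is the seed.  U k m is the
   (m+1)-th neighbor selected while the walk stands at X k; it is constrained
   only as long as U k 0, ..., U k (m-1) are all private, i.e. as long as the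
   (m+1)-th selection takes place.  Conditionally on the samples X 0, ..., X k
   and on the rejected selections U k 0, ..., U k (m-1), it is uniform on the
   neighbors of X k in G; this is stated in product form, so that no event has
   to be assumed of positive probability. *)
Record designed_random_walk (d : measure_display) (T : measurableType d)
    (R : realType) (P : probability T R) (n : nat) (e : rel 'I_n)
    (pub Vs : {set 'I_n}) (X : nat -> T -> 'I_n)
    (U : nat -> nat -> T -> 'I_n) : Prop := DesignedRandomWalk {
  walk_measurable_sample : forall (k : nat) (i : 'I_n),
    measurable [set w | X k w = i];
  walk_measurable_selection : forall (k m : nat) (i : 'I_n),
    measurable [set w | U k m w = i];
  walk_seed : forall w : T, X 0%N w \in Vs;
  walk_select : forall (k m : nat) (x u : nat -> 'I_n),
    (forall j : nat, (j < m)%N -> u j \notin pub) ->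
    P [set w | [/\ forall l : nat, (l <= k)%N -> X l w = x l,
                   forall j : nat, (j < m)%N -> U k j w = u j
                 & U k m w = u m]] =
    (P [set w | (forall l : nat, (l <= k)%N -> X l w = x l) /\
                (forall j : nat, (j < m)%N -> U k j w = u j)] *
     (uniform_neighbor R e (x k) (u m))%:E)%E;
  walk_accept : forall (k m : nat) (w : T),
    (forall j : nat, (j < m)%N -> U k j w \notin pub) ->
    U k m w \in pub -> X k.+1 w = U k m w
}.

Definition sample_law (d : measure_display) (T : measurableType d)
    (R : realType) (P : probability T R) (n : nat)
    (X : nat -> T -> 'I_n) (r : nat) : 'rV[R]_n :=
  \row_(i < n) fine (P [set w | X r w = i]).

Definition limit_law (R : realType) (n : nat) (e : rel 'I_n)
    (Vs : {set 'I_n}) : 'rV[R]_n :=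
  \row_(i < n) ((public_degree e Vs i)%:R / (total_public_degree e Vs)%:R
                * (i \in Vs)%:R).

(* Main.v *)
(* Inside a non-bipartite public-cluster there is an odd closed walk, so for some
   K any two nodes of V* are joined by a walk of exactly K steps.  The rejected
   selections form a geometric series, which gives
     P(X_k = i, X_(k+1) = u) >= P(X_k = i) / d*_i
   for every public neighbor u of i; since both sides sum to 1, these are
   equalities.  Hence f_k(i) = P(X_k = i) / d*_i evolves by averaging over
   neighbors in the cluster, so an interval containing the values of f_k remains
   valid for later k and can be shortened by a fixed factor every K steps.
   The limit is the constant 1 / D* because sum_i d*_i f_k(i) = 1. *)
Require Import Defs.
From mathcomp Require Import all_boot all_order all_algebra.
From mathcomp Require Import all_classical all_reals all_analysis.
From mathcomp Require Import ring lra.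

Set Implicit Arguments.
Unset Strict Implicit.
Unset Printing Implicit Defensive.

Import Order.TTheory GRing.Theory Num.Theory.
Import numFieldNormedType.Exports.

Local Open Scope classical_set_scope.
Local Open Scope ring_scope.

(** * Walks of prescribed length *)

Definition has_walk (V : finType) (E : rel V) (m : nat) (i j : V) : Prop :=
  exists p : seq V, [/\ path E i p, last i p = j & size p = m].

Lemma has_walk_cat (V : finType) (E : rel V) (m1 m2 : nat) (i j l : V) :
  has_walk E m1 i j -> has_walk E m2 j l -> has_walk E (m1 + m2) i l.
Proof.
move=> [p [pi pj <-]] [q [qj ql <-]]; exists (p ++ q).
by rewrite cat_path pi pj qj last_cat pj ql size_cat.
Qed.

Lemma has_walk1 (V : finType) (E : rel V) (i j : V) :
  E i j -> has_walk E 1 i j.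
Proof. by move=> eij; exists [:: j]; rewrite /= eij. Qed.

Lemma has_walk_sym (V : finType) (E : rel V) (m : nat) (i j : V) :
  symmetric E -> has_walk E m i j -> has_walk E m j i.
Proof.
move=> Esym [p [pi <- <-]]; exists (rev (belast i p)).
rewrite rev_path size_rev size_belast; split=> //.
  by rewrite (eq_path (e' := E)) // => x y; rewrite /= Esym.
by case: p pi => //= x p _; rewrite rev_cons last_rcons.
Qed.

Lemma has_walk_last (V : finType) (E : rel V) (m : nat) (i j : V) :
  has_walk E m.+1 i j -> exists2 l, has_walk E m i l & E l j.
Proof.
move=> [p [+ + pm]]; case/lastP: p pm => // p x.
rewrite size_rcons rcons_path last_rcons => -[pm] /andP[pi lx] <-.
by exists (last i p) => //; exists p.
Qed.

(** Going back and forth along an edge at the endpoint adds two steps, so a length can be raised to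
    any larger one of the same parity. *)
Lemma has_walk_pad (V : finType) (E : rel V) (m k : nat) (i j l : V) :
  symmetric E -> E j l -> has_walk E m i j -> has_walk E (m + k.*2) i j.
Proof.
move=> Esym ejl wm; elim: k => [|k IH]; first by rewrite addn0.
rewrite doubleS -addn2 addnA; apply: has_walk_cat IH _.
by apply: has_walk_cat (has_walk1 ejl) _; apply: has_walk1; rewrite Esym.
Qed.

(** Colour each node by whether an even walk from [v] reaches it. Both ends of a monochromatic edge
    are then reached by walks of equal parity, and closing up through that edge gives an odd closed
    walk. *)
Lemma odd_closed_walk (V : finType) (E : rel V) (v : V) :
  symmetric E ->
  (forall c : V -> bool, exists i j, E i j /\ c i = c j) ->
  (forall i j, E i j -> connect E v i) ->
  exists k, has_walk E k.*2.+1 v v.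
Proof.
move=> Esym nonbip conn.
have [i [j [eij cij]]] :=
  nonbip (fun i => `[< exists k, has_walk E k.*2 v i >]).
have wk l l' : E l l' -> exists k, has_walk E k v l.
  by move=> /conn /connectP[p pv ->]; exists (size p), p.
have join a b : odd a = odd b -> has_walk E a v i -> has_walk E b v j ->
    exists k, has_walk E k.*2.+1 v v.
  move=> ab wi wj; exists ((a + b)./2).
  have := has_walk_cat (has_walk_cat wi (has_walk1 eij)) (has_walk_sym Esym wj).
  by rewrite addn1 addSn -[in X in has_walk E X.+1](odd_double_half (a + b))
             oddD ab addbb.
have even a l : has_walk E a v l -> ~~ odd a -> exists k, has_walk E k.*2 v l.
  by move=> w oa; exists a./2; rewrite even_halfK.
have [a wi] := wk _ _ eij.
have [b wj] : exists k, has_walk E k v j by apply: (wk j i); rewrite Esym.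
have [|] := boolP (`[< exists k, has_walk E k.*2 v i >]) => ci.
  have cj := ci; rewrite cij in cj.
  move: ci cj => /asboolP[k wi'] /asboolP[k' wj'].
  by apply: join wi' wj'; rewrite !odd_double.
have cj := ci; rewrite cij in cj.
have oa : odd a by apply: contraNT ci => oa; apply/asboolP; exact: even wi oa.
have ob : odd b by apply: contraNT cj => ob; apply/asboolP; exact: even wj ob.
by apply: join wi wj; rewrite oa ob.
Qed.

(** The odd closed walk corrects parity, so each node of [S] is reached from [v] by an even walk.
    Padding brings these walks to the common length [A.*2], and two of them joined at [v] give
    [K]. *)
Lemma uniform_walk_length (V : finType) (E : rel V) (S : {set V}) (v : V) :
  symmetric E ->
  (forall i, i \in S -> connect E v i) ->
  (forall i, i \in S -> exists j, E i j) ->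
  (exists k, has_walk E k.*2.+1 v v) ->
  exists K, forall i j, i \in S -> j \in S -> has_walk E K i j.
Proof.
move=> Esym conn deg [k wv].
(* Membership in [S] stands under the existential so that [choice] yields a total function; outside
   [S] its value is a dummy. *)
have ev i : exists a, i \in S -> has_walk E a.*2 v i.
  have [iS|] := boolP (i \in S); last by exists 0%N.
  have /connectP[p pv pl] := conn _ iS.
  have wp : has_walk E (size p) v i by exists p.
  have [op|op] := boolP (odd (size p)).
    exists (k.*2.+1 + size p)./2 => _.
    by rewrite even_halfK ?oddD /= ?odd_double ?op //; apply: has_walk_cat wv wp.
  by exists (size p)./2; rewrite even_halfK.
have [a aP] := choice ev.
pose A := (\max_i a i)%N.
have wA i : i \in S -> has_walk E A.*2 v i.
  move=> iS; have [j eij] := deg _ iS.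
  have := has_walk_pad (A - a i) Esym eij (aP _ iS).
  by rewrite -doubleD subnKC //; apply: leq_bigmax.
exists (A.*2 + A.*2)%N => i j iS jS.
by apply: has_walk_cat (wA _ jS); apply: has_walk_sym => //; apply: wA.
Qed.

(** * Iterated neighborhood averages *)

Definition nbr_mean (R : realType) (V : finType) (E : rel V)
    (g : V -> R) (j : V) : R :=
  (\sum_(i | E j i) g i) / #|E j|%:R.

(** A nonzero constant is its own mean only where the degree is nonzero: at degree 0 the division
    returns 0. *)
Lemma nbr_mean_affine (R : realType) (V : finType) (E : rel V)
    (a b : R) (g : V -> R) (j : V) :
  (0 < #|E j|)%N ->
  nbr_mean E (fun i => a * g i + b) j = a * nbr_mean E g j + b.
Proof.
move=> dj; have d0 : #|E j|%:R != 0 :> R by rewrite pnatr_eq0 -lt0n.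
rewrite /nbr_mean big_split /= -mulr_sumr sumr_const -[b *+ _]mulr_natr mulrDl mulrA.
by rewrite mulfK.
Qed.

(** One term of the sum is kept and the degree is bounded by [#|V|], which gives a factor
    independent of [j]. *)
Lemma nbr_mean_ge (R : realType) (V : finType) (E : rel V) (g : V -> R)
    (i j : V) :
  (forall l, E j l -> 0 <= g l) -> E j i ->
  #|V|%:R^-1 * g i <= nbr_mean E g j.
Proof.
move=> g0 eji.
have d0 : (0 < #|E j|)%N by apply/card_gt0P; exists i.
rewrite mulrC /nbr_mean ler_pM ?g0 ?invr_ge0 //.
  by rewrite (bigD1 i) //= lerDl sumr_ge0 // => l /andP[/g0].
by rewrite lef_pV2 ?posrE ?ltr0n ?ler_nat ?max_card // (leq_trans d0) ?max_card.
Qed.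

Definition mean_iterates (R : realType) (V : finType) (E : rel V)
    (S : {set V}) (f : nat -> V -> R) : Prop :=
  forall k j, j \in S -> f k.+1 j = nbr_mean E (f k) j.

(** Used with coefficients 1, [- a] and -1, [b], this reduces the two bounds of an interval to
    nonnegativity of mean iterates. *)
Lemma mean_iterates_affine (R : realType) (V : finType) (E : rel V)
    (S : {set V}) (f : nat -> V -> R) (a b : R) :
  (forall i, i \in S -> (0 < #|E i|)%N) ->
  mean_iterates E S f -> mean_iterates E S (fun k i => a * f k i + b).
Proof. by move=> deg fE k j jS; rewrite nbr_mean_affine ?deg // fE. Qed.

Lemma mean_iterates_ge0 (R : realType) (V : finType) (E : rel V)
    (S : {set V}) (f : nat -> V -> R) (k : nat) :
  (forall i j, E i j -> j \in S) -> mean_iterates E S f ->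
  (forall i, i \in S -> 0 <= f k i) ->
  forall m i, i \in S -> 0 <= f (k + m)%N i.
Proof.
move=> ES fE f0; elim=> [|m IH] i iS; first by rewrite addn0 f0.
by rewrite addnS fE // /nbr_mean divr_ge0 // sumr_ge0 // => j /ES; apply: IH.
Qed.

(** Each edge of the walk costs at most a factor [#|V|%:R^-1]; the induction peels off the last
    edge, read backwards by symmetry. *)
Lemma mean_iterates_walk (R : realType) (V : finType) (E : rel V)
    (S : {set V}) (f : nat -> V -> R) (k m : nat) (i j : V) :
  symmetric E -> (forall i j, E i j -> j \in S) -> mean_iterates E S f ->
  (forall l, l \in S -> 0 <= f k l) -> has_walk E m i j ->
  #|V|%:R^-1 ^+ m * f k i <= f (k + m)%N j.
Proof.
move=> Esym ES fE f0; elim: m j => [|m IH] j.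
  by case=> p [_ <- /size0nil ->]; rewrite /= addn0 expr0 mul1r.
move=> /has_walk_last[l wl elj].
rewrite addnS fE ?(ES _ _ elj) // exprS -mulrA.
have ejl : E j l by rewrite Esym.
apply: le_trans (nbr_mean_ge _ ejl).
  by rewrite ler_wpM2l ?invr_ge0 // IH.
by move=> x /ES; apply: mean_iterates_ge0 ES fE f0 m x.
Qed.

(* One of the two halves of [a, b] contains the value at v; walks of length K
   spread the distance to the opposite endpoint over all of S. *)
Lemma mean_iterates_contract (R : realType) (V : finType) (E : rel V)
    (S : {set V}) (f : nat -> V -> R) (K k : nat) (v : V) (a b : R) :
  symmetric E -> (forall i j, E i j -> j \in S) ->
  (forall i, i \in S -> (0 < #|E i|)%N) -> v \in S ->
  (forall j, j \in S -> has_walk E K v j) -> mean_iterates E S f ->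
  (forall i, i \in S -> a <= f k i <= b) ->
  exists a' b', b' - a' = (1 - #|V|%:R^-1 ^+ K / 2) * (b - a) /\
    forall i, i \in S -> a' <= f (k + K)%N i <= b'.
Proof.
move=> Esym ES deg vS wK fE fab; set q := #|V|%:R^-1 ^+ K.
have q0 : 0 <= q by rewrite exprn_ge0 ?invr_ge0.
pose lo m i := 1 * f m i + - a; pose hi m i := -1 * f m i + b.
have loE : mean_iterates E S lo by apply: mean_iterates_affine.
have hiE : mean_iterates E S hi by apply: mean_iterates_affine.
have lo0 i : i \in S -> 0 <= lo k i by move=> /fab; rewrite /lo; lra.
have hi0 i : i \in S -> 0 <= hi k i by move=> /fab; rewrite /hi; lra.
have [fv|fv] := lerP (f k v) ((a + b) / 2).
  (* The gap between [f k v] and [b] is at least half of [b - a], and a share [q] of it reaches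
     every node of [S]. The other case mirrors this one. *)
  exists a, (b - q / 2 * (b - a)); split=> [|i iS]; first by ring.
  have := mean_iterates_ge0 ES loE lo0 K iS.
  have := mean_iterates_walk Esym ES hiE hi0 (wK _ iS).
  rewrite -/q /lo /hi => h1 h2.
  have : q * ((b - a) / 2) <= q * (-1 * f k v + b) by rewrite ler_wpM2l //; lra.
  lra.
exists (a + q / 2 * (b - a)), b; split=> [|i iS]; first by ring.
have := mean_iterates_ge0 ES hiE hi0 K iS.
have := mean_iterates_walk Esym ES loE lo0 (wK _ iS).
rewrite -/q /lo /hi => h1 h2.
have : q * ((b - a) / 2) <= q * (1 * f k v + - a) by rewrite ler_wpM2l //; lra.
lra.
Qed.

Lemma mean_iterates_osc (R : realType) (V : finType) (E : rel V)
    (S : {set V}) (f : nat -> V -> R) (K : nat) (v : V) :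
  symmetric E -> (forall i j, E i j -> j \in S) ->
  (forall i, i \in S -> (0 < #|E i|)%N) -> v \in S ->
  (forall j, j \in S -> has_walk E K v j) -> mean_iterates E S f ->
  (forall i, i \in S -> 0 <= f 0%N i <= 1) ->
  forall m, exists a b, b - a = (1 - #|V|%:R^-1 ^+ K / 2) ^+ m /\
    forall k, (m * K <= k)%N -> forall i, i \in S -> a <= f k i <= b.
Proof.
move=> Esym ES deg vS wK fE f01 m.
(* An interval valid at time [m * K] stays valid later, because [f - a] and [b - f] are mean
   iterates and so remain nonnegative. *)
suff [a [b [ab fab]]] : exists a b, b - a = (1 - #|V|%:R^-1 ^+ K / 2) ^+ m /\
    forall i, i \in S -> a <= f (m * K)%N i <= b.
  exists a, b; split=> // k /subnKC <- i iS.
  have loE := mean_iterates_affine 1 (- a) deg fE.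
  have hiE := mean_iterates_affine (-1) b deg fE.
  have := mean_iterates_ge0 (k := (m * K)%N) ES loE _ (k - m * K) iS.
  have := mean_iterates_ge0 (k := (m * K)%N) ES hiE _ (k - m * K) iS.
  move=> h1 h2; apply/andP; split.
    by rewrite -subr_ge0; move: h2; rewrite mul1r; apply=> l /fab; lra.
  by rewrite -subr_ge0; move: h1; rewrite mulN1r addrC; apply=> l /fab; lra.
elim: m => [|m [a [b [ab fab]]]]; first by exists 0, 1; rewrite subr0 expr0.
have [a' [b' [ab' fab']]] :=
  mean_iterates_contract Esym ES deg vS wK fE fab.
by exists a', b'; rewrite ab' ab exprS mulSnr.
Qed.

(** Total mass 1 makes [D^-1] the degree-weighted average of [f = p / deg] at every time. It
    therefore lies in each interval that contains the values of [f], and the length of that interval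
    bounds the error. *)
Lemma reversible_chain_cvg (R : realType) (V : finType) (E : rel V)
    (S : {set V}) (p : nat -> V -> R) (K : nat) (v : V) :
  symmetric E -> (forall i j, E i j -> j \in S) ->
  (forall i, i \in S -> (0 < #|E i|)%N) -> v \in S ->
  (forall j, j \in S -> has_walk E K v j) ->
  (forall k i, i \in S -> 0 <= p k i) ->
  (forall k, \sum_(i in S) p k i = 1) ->
  (forall k j, j \in S -> p k.+1 j = \sum_(i | E j i) p k i / #|E i|%:R) ->
  forall j, j \in S ->
  p k j @[k --> \oo] --> (#|E j|%:R / (\sum_(i in S) #|E i|)%:R : R).
Proof.
move=> Esym ES deg vS wK p0 p1 pE j jS.
have d0 i : i \in S -> 0 < #|E i|%:R :> R by move=> /deg; rewrite ltr0n.
have dge1 i : i \in S -> 1 <= #|E i|%:R :> R by move=> /deg; rewrite ler1n.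
pose f k i := p k i / #|E i|%:R.
have fE : mean_iterates E S f by move=> k i iS; rewrite /f pE.
have fp k i : i \in S -> p k i = f k i * #|E i|%:R.
  by move=> iS; rewrite divfK // gt_eqF ?d0.
have f01 i : i \in S -> 0 <= f 0%N i <= 1.
  move=> iS; rewrite divr_ge0 ?p0 //= ler_pdivrMr ?d0 // mul1r.
  rewrite (le_trans _ (dge1 _ iS)) // -(p1 0%N) (bigD1 i) //= lerDl sumr_ge0 //.
  by move=> l /andP[lS _]; apply: p0.
pose D : R := (\sum_(i in S) #|E i|)%:R.
have DE : D = \sum_(i in S) #|E i|%:R by rewrite /D natr_sum.
have D0 : 0 < D.
  rewrite DE (bigD1 v) //= ltr_wpDr ?d0 // sumr_ge0 //.
set q : R := 1 - #|V|%:R^-1 ^+ K / 2.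
have V1 : 1 <= #|V|%:R :> R by rewrite ler1n; apply/card_gt0P; exists v.
have u0 : 0 < #|V|%:R^-1 ^+ K :> R by rewrite exprn_gt0 // invr_gt0; lra.
have u1 : #|V|%:R^-1 ^+ K <= 1 :> R.
  by rewrite exprn_ile1 ?invr_ge0 // ?invf_le1; lra.
have q1 : `|q| < 1 by rewrite ltr_norml /q; lra.
apply/cvgrPdist_lt => eps eps0.
(* The error of [p] at [j] is the error of [f] times the degree of [j]. *)
have e0 : 0 < eps / #|E j|%:R by rewrite divr_gt0 ?d0.
have /cvgrPdist_lt/(_ _ e0)[N _ /(_ N (leqnn N))] := cvg_expr q1.
rewrite /= sub0r normrN => qN.
have [a [b [ab fab]]] := mean_iterates_osc Esym ES deg vS wK fE f01 N.
exists (N * K)%N => // k /= Nk.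
have fk := fab _ Nk.
have aD : a <= D^-1.
  rewrite -[D^-1]mul1r ler_pdivlMr // DE mulr_sumr -[leRHS](p1 k).
  by apply: ler_sum => i iS; rewrite fp // ler_wpM2r //; case/andP: (fk _ iS).
have bD : D^-1 <= b.
  rewrite -[D^-1]mul1r ler_pdivrMr // DE mulr_sumr -[leLHS](p1 k).
  by apply: ler_sum => i iS; rewrite fp // ler_wpM2r //; case/andP: (fk _ iS).
rewrite -/D fp // [f k j * _]mulrC -mulrBr normrM ger0_norm // mulrC.
rewrite -ltr_pdivlMr ?d0 //; apply: le_lt_trans qN; rewrite -ab.
rewrite [leRHS]ger0_norm; last by lra.
by have /andP[] := fk _ jS; rewrite ler_norml; lra.
Qed.

(** * Events of finitely valued random variables *)

Definition pr (d : measure_display) (T : measurableType d) (R : realType)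
  (P : probability T R) (A : set T) : R := fine (P A).

Lemma pr_ge0 (d : measure_display) (T : measurableType d) (R : realType)
    (P : probability T R) (A : set T) : 0 <= pr P A.
Proof. by rewrite fine_ge0. Qed.

Lemma pr_le (d : measure_display) (T : measurableType d) (R : realType)
    (P : probability T R) (A B : set T) :
  measurable A -> measurable B -> A `<=` B -> pr P A <= pr P B.
Proof.
move=> mA mB AB; rewrite fine_le ?fin_num_measure //.
by rewrite le_measure ?inE.
Qed.

Lemma pr_disjoint_le (d : measure_display) (T : measurableType d)
    (R : realType) (P : probability T R) (A B C : set T) :
  measurable A -> measurable B -> measurable C ->
  A `<=` C -> B `<=` C -> (forall w, A w -> ~ B w) ->
  pr P A + pr P B <= pr P C.
Proof.
move=> mA mB mC AC BC AB.
rewrite -fineD ?fin_num_measure // -measureU //.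
  by apply: pr_le => //; [exact: measurableU | rewrite subUset].
by apply/seteqP; split=> // w [/AB].
Qed.

(** Measurability is asked fibre by fibre, as in [designed_random_walk]; since [F] is finite, this
    covers the preimage of every subset. *)
Definition finite_rv (d : measure_display) (T : measurableType d)
    (F : finType) (f : T -> F) : Prop :=
  forall y : F, measurable [set w | f w = y].

Lemma finite_rv_measurable (d : measure_display) (T : measurableType d)
    (F : finType) (f : T -> F) (Q : pred F) :
  finite_rv f -> measurable [set w | Q (f w)].
Proof.
move=> mf.
rewrite (_ : [set w | Q (f w)] = \bigcup_(y in [set` Q]) [set w | f w = y]).
  by apply: fin_bigcup_measurable => // y _; apply: mf.
by apply/seteqP; split=> [w Qw|w [y /= Qy fw]]; [exists (f w) | rewrite /= fw].
Qed.

Lemma finite_rv_ffun (d : measure_display) (T : measurableType d)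
    (I F : finType) (f : I -> T -> F) :
  (forall i, finite_rv (f i)) -> finite_rv (fun w => [ffun i => f i w]).
Proof.
move=> mf y.
rewrite (_ : [set w | _] = \bigcap_(i in [set: I]) [set w | f i w = y i]).
  by apply: fin_bigcap_measurable => // i _; apply: mf.
apply/seteqP; split=> [w /= <- i _|w yw] /=; first by rewrite ffunE.
by apply/ffunP => i; rewrite ffunE yw.
Qed.

Lemma finite_rv_pair (d : measure_display) (T : measurableType d)
    (F G : finType) (f : T -> F) (g : T -> G) :
  finite_rv f -> finite_rv g -> finite_rv (fun w => (f w, g w)).
Proof.
move=> mf mg [y z].
rewrite (_ : [set w | _] = [set w | f w = y] `&` [set w | g w = z]).
  exact: measurableI (mf y) (mg z).
by apply/seteqP; split=> w /= [-> ->].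
Qed.

Lemma pr_total (d : measure_display) (T : measurableType d) (R : realType)
    (P : probability T R) (F : finType) (f : T -> F) (Q : pred F)
    (B : set T) :
  finite_rv f -> measurable B ->
  pr P [set w | Q (f w) /\ B w] =
  \sum_(y | Q y) pr P [set w | f w = y /\ B w].
Proof.
move=> mf mB; pose G y := [set w | f w = y] `&` B.
have mG y : measurable (G y) by exact: measurableI (mf y) mB.
rewrite (_ : [set w | _] = \bigcup_(y in [set` Q]) G y); last first.
  by apply/seteqP; split=> [w [Qw Bw]|w [y /= Qy [fw Bw]]]; [exists (f w) | rewrite /= fw].
rewrite /pr measure_fin_bigcup //; last first.
  by move=> y z _ _ [w [[/= <- _] [<- _]]].
rewrite -(bigfs _ (index_enum_uniq F)); last by move=> i _; rewrite mem_index_enum.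
by rewrite -sum_fine // => y _; rewrite fin_num_measure.
Qed.

Lemma pr_total_setT (d : measure_display) (T : measurableType d)
    (R : realType) (P : probability T R) (F : finType) (f : T -> F)
    (Q : pred F) :
  finite_rv f ->
  pr P [set w | Q (f w)] = \sum_(y | Q y) pr P [set w | f w = y].
Proof.
move=> mf; rewrite -[X in pr P X = _]setIT.
rewrite (pr_total P Q mf measurableT).
by apply: eq_bigr => y _; rewrite -[X in _ = pr P X]setIT.
Qed.

Lemma pr_sum1 (d : measure_display) (T : measurableType d)
    (R : realType) (P : probability T R) (F : finType) (f : T -> F) :
  finite_rv f -> \sum_y pr P [set w | f w = y] = 1.
Proof.
move=> mf; rewrite -(pr_total_setT P predT mf) /pr.
by rewrite (_ : [set w | _] = setT) ?probability_setT //; apply/seteqP; split.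
Qed.

(** * The designed random walk *)

(** Histories must range over a finite type to be summed over, whereas [walk_select] takes sequences
    on [nat]. The value [u] at index [m] will serve as the next selection. *)
Definition extend_ffun (n m : nat) (u : 'I_n) (s : {ffun 'I_m -> 'I_n})
    (l : nat) : 'I_n :=
  if insub l is Some o then s o else u.

Lemma extend_ffun_ord (n m : nat) (u : 'I_n) (s : {ffun 'I_m -> 'I_n})
    (o : 'I_m) :
  extend_ffun u s o = s o.
Proof. by rewrite /extend_ffun valK. Qed.

Lemma extend_ffun_out (n m : nat) (u : 'I_n) (s : {ffun 'I_m -> 'I_n}) :
  extend_ffun u s m = u.
Proof. by rewrite /extend_ffun insubN // ltnn. Qed.

Lemma eq_extend_ffun (n m : nat) (u : 'I_n) (s : {ffun 'I_m -> 'I_n})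
    (g : nat -> 'I_n) :
  [ffun o : 'I_m => g o] = s <->
  forall l, (l < m)%N -> g l = extend_ffun u s l.
Proof.
split=> [<- l lm|gs].
  by rewrite -[l]/(val (Ordinal lm)) extend_ffun_ord ffunE.
by apply/ffunP => o; rewrite ffunE gs ?extend_ffun_ord.
Qed.

Definition all_rejected (T : Type) (n : nat) (pub : {set 'I_n})
    (U : nat -> T -> 'I_n) (m : nat) (w : T) : bool :=
  [forall j : 'I_m, U j w \notin pub].

Lemma all_rejectedP (T : Type) (n : nat) (pub : {set 'I_n})
    (U : nat -> T -> 'I_n) (m : nat) (w : T) :
  reflect (forall j, (j < m)%N -> U j w \notin pub) (all_rejected pub U m w).
Proof.
apply: (iffP forallP) => [H j jm|H j]; last exact: H.
exact: (H (Ordinal jm)).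
Qed.

Lemma all_rejectedS (T : Type) (n : nat) (pub : {set 'I_n})
    (U : nat -> T -> 'I_n) (m : nat) (w : T) :
  all_rejected pub U m.+1 w = all_rejected pub U m w && (U m w \notin pub).
Proof.
apply/all_rejectedP/andP => [H|[/all_rejectedP H um] j].
  by split; [apply/all_rejectedP => j /ltnW; apply: H | apply: H].
by rewrite ltnS leq_eqVlt => /predU1P[->|/H].
Qed.

Lemma all_rejected_measurable (d : measure_display) (T : measurableType d)
    (n : nat) (pub : {set 'I_n}) (U : nat -> T -> 'I_n) (m : nat) :
  (forall j, finite_rv (U j)) -> measurable [set w | all_rejected pub U m w].
Proof.
move=> mU; elim: m => [|m IH].
  by rewrite (_ : [set w | _] = setT) //; apply/seteqP; split=> // w _;
     apply/forallP => -[].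
rewrite (_ : [set w | _] = [set w | all_rejected pub U m w] `&`
                           [set w | U m w \notin pub]).
  exact: measurableI IH (finite_rv_measurable (fun u => u \notin pub) (mU m)).
by apply/seteqP; split=> w /=; rewrite all_rejectedS => /andP.
Qed.

Lemma measurable_sample_rejected (d : measure_display) (T : measurableType d)
    (R : realType) (P : probability T R) (n : nat) (e : rel 'I_n)
    (pub Vs : {set 'I_n}) (X : nat -> T -> 'I_n) (U : nat -> nat -> T -> 'I_n)
    (k m : nat) (i : 'I_n) :
  designed_random_walk P e pub Vs X U ->
  measurable [set w | X k w = i /\ all_rejected pub (U k) m w].
Proof.
move=> walk; apply: (@measurableI _ _ [set w | X k w = i]).
  exact: walk_measurable_sample walk k i.
apply: all_rejected_measurable => j u.
exact: walk_measurable_selection walk k j u.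
Qed.

(** [walk_select] conditions on a full history. Summing over all histories that end in [i] with only
    private selections leaves the event on the current state, since the factor depends on [i] and
    [u] alone. *)
Lemma pr_selection (d : measure_display) (T : measurableType d)
    (R : realType) (P : probability T R) (n : nat) (e : rel 'I_n)
    (pub Vs : {set 'I_n}) (X : nat -> T -> 'I_n) (U : nat -> nat -> T -> 'I_n)
    (k m : nat) (i u : 'I_n) :
  designed_random_walk P e pub Vs X U ->
  pr P [set w | (X k w = i /\ all_rejected pub (U k) m w) /\ U k m w = u] =
  pr P [set w | X k w = i /\ all_rejected pub (U k) m w] *
  uniform_neighbor R e i u.
Proof.
move=> walk.
pose Z w := ([ffun l : 'I_k.+1 => X l w], [ffun j : 'I_m => U k j w]).
have mZ : finite_rv Z.
  apply: finite_rv_pair; apply: finite_rv_ffun => l x.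
    exact: walk_measurable_sample walk l x.
  exact: walk_measurable_selection walk k l x.
pose Q (y : {ffun 'I_k.+1 -> 'I_n} * {ffun 'I_m -> 'I_n}) :=
  (y.1 ord_max == i) && [forall j, y.2 j \notin pub].
have QZ w : (X k w = i /\ all_rejected pub (U k) m w) <-> Q (Z w).
  rewrite /Q /= ffunE.
  under [in X in _ <-> X]eq_forallb do rewrite ffunE.
  by split=> [[-> rej]|/andP[/eqP ->]] //; rewrite eqxx.
rewrite (_ : [set w | X k w = i /\ _] = [set w | Q (Z w)]); last first.
  by apply/seteqP; split=> w /QZ.
rewrite (_ : [set w | _] = [set w | Q (Z w) /\ U k m w = u]); last first.
  by apply/seteqP; split=> w [/QZ].
rewrite pr_total //; last exact: walk_measurable_selection walk k m u.
rewrite pr_total_setT // mulr_suml; apply: eq_bigr => -[x s] /andP[/= xi priv].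
have privE j : (j < m)%N -> extend_ffun u s j \notin pub.
  move=> jm; rewrite -[j]/(val (Ordinal jm)) extend_ffun_ord.
  exact: (forallP priv).
have ZE w : Z w = (x, s) <->
    (forall l, (l <= k)%N -> X l w = extend_ffun u x l) /\
    (forall j, (j < m)%N -> U k j w = extend_ffun u s j).
  split=> [[/(eq_extend_ffun u x (X^~ w)) ? /(eq_extend_ffun u s (U k ^~ w)) ?]|].
    by split.
  by rewrite /Z => -[/(eq_extend_ffun u x (X^~ w)) <-
                     /(eq_extend_ffun u s (U k ^~ w)) <-].
(* Only the first [m] entries have to be private; entry [m] of the extended sequence is [u], and the
   last sample is [x ord_max], that is [i]. *)
have := walk_select walk k (extend_ffun u x) privE.
rewrite extend_ffun_out -[X in uniform_neighbor _ _ (extend_ffun u x X)]/(val (@ord_max k)).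
rewrite extend_ffun_ord (eqP xi).
rewrite (_ : [set w | _ /\ _] = [set w | Z w = (x, s)]); last first.
  by apply/seteqP; split=> w /ZE.
rewrite /pr (_ : [set w | [/\ _, _ & _]] = [set w | Z w = (x, s) /\ U k m w = u]).
  by move=> ->; rewrite fineM ?fin_num_measure.
by apply/seteqP; split=> [w [? ? ?]|w [/ZE[? ?] ?]]; split=> //; apply/ZE.
Qed.

Lemma sum_uniform_neighbor (R : realType) (n : nat) (e : rel 'I_n)
    (i : 'I_n) (A : {set 'I_n}) :
  \sum_(u in A) uniform_neighbor R e i u =
  #|neighbors e i :&: A|%:R / #|neighbors e i|%:R.
Proof.
rewrite -mulr_suml -natr_sum; congr (_%:R / _).
rewrite -sum1_card big_mkcond [RHS]big_mkcond /=.
by apply: eq_bigr => u _; rewrite finset.in_setI; case: (u \in A); case: (u \in _).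
Qed.

(** Each further rejection multiplies the probability by the proportion of private nodes among the
    neighbors of [i]. *)
Lemma pr_all_rejected (d : measure_display) (T : measurableType d)
    (R : realType) (P : probability T R) (n : nat) (e : rel 'I_n)
    (pub Vs : {set 'I_n}) (X : nat -> T -> 'I_n) (U : nat -> nat -> T -> 'I_n)
    (k m : nat) (i : 'I_n) :
  designed_random_walk P e pub Vs X U ->
  pr P [set w | X k w = i /\ all_rejected pub (U k) m w] =
  pr P [set w | X k w = i] *
    (#|neighbors e i :&: ~: pub|%:R / #|neighbors e i|%:R) ^+ m.
Proof.
move=> walk; elim: m => [|m IH].
  rewrite expr0 mulr1; congr (pr P _); apply/seteqP; split=> w /=; first by case.
  by move=> xi; split=> //; apply/forallP => -[].
rewrite -sum_uniform_neighbor exprSr mulrA sum_uniform_neighbor -IH.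
(* The last factor is expanded over the private values of [U k m], to match the decomposition of the
   event by that value. *)
rewrite -sum_uniform_neighbor mulr_sumr.
pose B := [set w | X k w = i /\ all_rejected pub (U k) m w].
rewrite (_ : [set w | _] = [set w | U k m w \in ~: pub /\ B w]).
  rewrite (@pr_total _ _ _ _ _ (U k m) (fun u => u \in ~: pub)).
  - apply: eq_bigr => u _; rewrite -(pr_selection _ _ _ _ walk).
    by congr (pr P _); apply/seteqP; split=> w [].
  - exact: walk_measurable_selection walk k m.
  - exact: measurable_sample_rejected walk.
apply/seteqP; split=> w; rewrite /B /= all_rejectedS inE.
  by move=> [-> /andP[-> ->]].
by move=> [-> [-> ->]].
Qed.

(** The events that the first public selection is [u] and occurs at attempt [m] are disjoint for
    distinct [m], and each forces the next sample to be [u]. *)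
Lemma pr_accepted_ge (d : measure_display) (T : measurableType d)
    (R : realType) (P : probability T R) (n : nat) (e : rel 'I_n)
    (pub Vs : {set 'I_n}) (X : nat -> T -> 'I_n) (U : nat -> nat -> T -> 'I_n)
    (k M : nat) (i u : 'I_n) :
  designed_random_walk P e pub Vs X U -> u \in pub ->
  \sum_(m < M) pr P [set w | X k w = i /\ all_rejected pub (U k) m w] *
    uniform_neighbor R e i u <=
  pr P [set w | X k w = i /\ X k.+1 w = u].
Proof.
move=> walk upub.
have mX l j : measurable [set w | X l w = j].
  exact: walk_measurable_sample walk l j.
have mXX : measurable [set w | X k w = i /\ X k.+1 w = u].
  exact: (@measurableI _ _ [set w | X k w = i] [set w | X k.+1 w = u]).
have mrej m : measurable [set w | all_rejected pub (U k) m w].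
  by apply: all_rejected_measurable => j y; exact: walk_measurable_selection walk k j y.
(* [C m] adds that a public node appeared among the first [m] selections. This strengthening makes
   [C M] disjoint from acceptance at attempt [M], as the induction requires. *)
pose C m := [set w | X k w = i /\ X k.+1 w = u] `\`
            [set w | all_rejected pub (U k) m w].
have mC m : measurable (C m) by exact: measurableD.
suff le_C : \sum_(m < M) pr P [set w | X k w = i /\ all_rejected pub (U k) m w] *
    uniform_neighbor R e i u <= pr P (C M).
  by apply: le_trans le_C _; apply: pr_le => // w [].
elim: M => [|M IH]; first by rewrite big_ord0 pr_ge0.
rewrite big_ord_recr /= -(pr_selection _ _ _ _ walk).
apply: le_trans (lerD IH (lexx _)) _; apply: pr_disjoint_le => //.
- apply: (@measurableI _ _ [set w | X k w = i /\ all_rejected pub (U k) M w]).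
    exact: measurable_sample_rejected walk.
  exact: walk_measurable_selection walk k M u.
- by move=> w [XX /negP rej]; split=> //=; rewrite all_rejectedS (negbTE rej).
- move=> w [[Xk /all_rejectedP rej] Uu]; split=> /=.
    by split=> //; rewrite (walk_accept walk rej) Uu.
  by rewrite all_rejectedS Uu upub andbF.
- by move=> w [_ rej] [[_ /rej]].
Qed.

(** The private share [rho] is below 1 because [u] is a public neighbor. The truncated geometric
    sums are [a / D * (1 - rho ^+ M)], and [M] tends to infinity. *)
Lemma pr_step_ge (d : measure_display) (T : measurableType d)
    (R : realType) (P : probability T R) (n : nat) (e : rel 'I_n)
    (pub Vs : {set 'I_n}) (X : nat -> T -> 'I_n) (U : nat -> nat -> T -> 'I_n)
    (k : nat) (i u : 'I_n) :
  designed_random_walk P e pub Vs X U -> u \in neighbors e i :&: pub ->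
  pr P [set w | X k w = i] / #|neighbors e i :&: pub|%:R <=
  pr P [set w | X k w = i /\ X k.+1 w = u].
Proof.
move=> walk uNp; have /setIP[uN upub] := uNp.
set a := pr P _; set b := pr P _.
set N : R := #|neighbors e i|%:R; set D : R := #|neighbors e i :&: pub|%:R.
set rho := #|neighbors e i :&: ~: pub|%:R / N.
have D0 : 0 < D by rewrite ltr0n; apply/card_gt0P; exists u.
have N0 : 0 < N by rewrite ltr0n; apply/card_gt0P; exists u.
have rhoE : 1 - rho = D / N.
  have -> : D = N - #|neighbors e i :&: ~: pub|%:R.
    by rewrite /N -(cardsID pub (neighbors e i)) natrD -finset.setDE addrK.
  by rewrite mulrBl divff ?gt_eqF.
have rho1 : `|rho| < 1.
  rewrite ger0_norm ?divr_ge0 // -subr_gt0 rhoE; exact: divr_gt0.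
have geo M : a / D * (1 - rho ^+ M) <= b.
  have := pr_accepted_ge k M i walk upub; rewrite -/b; congr (_ <= _).
  under eq_bigr do rewrite (pr_all_rejected _ _ _ walk) -/a -/N -/rho.
  rewrite /uniform_neighbor uN mulr1n -/N -mulr_suml -mulr_sumr.
  have : (1 - rho) * \sum_(m < M) rho ^+ m = 1 - rho ^+ M.
    by rewrite -opprB mulNr -subrX1 opprB.
  rewrite rhoE => <-; by field; rewrite (gt_eqF D0) (gt_eqF N0).
have : a / D * (1 - rho ^+ M) @[M --> \oo] --> a / D * (1 - 0).
  by apply: cvgM; [|apply: cvgB; last exact: cvg_expr]; exact: cvg_cst.
rewrite subr0 mulr1 => lim.
by apply: (cvgr_to_le lim); apply: nearW.
Qed.

(** * The public-cluster and the transition law on it *)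

Lemma induced_edgeE (n : nat) (e : rel 'I_n) (S : {set 'I_n}) (i j : 'I_n) :
  induced_edge e S i j = [&& i \in S, j \in S & e i j].
Proof. by []. Qed.

(** A component absorbs every public neighbor of its nodes. Hence public neighbors in G are exactly
    neighbors in the cluster, and a public path that starts in [Vs] never leaves it. *)
Lemma public_cluster_connected (n : nat) (e : rel 'I_n) (pub Vs : {set 'I_n}) :
  Vs \in public_clusters e pub ->
  [/\ Vs \subset pub,
      forall i, i \in Vs -> neighbors e i :&: pub = [set j | induced_edge e Vs i j]%SET
    & exists2 v, v \in Vs &
        forall i, i \in Vs -> connect (induced_edge e Vs) v i].
Proof.
case/imsetP=> v vpub VsE.
have memVs i : (i \in Vs) = connect (induced_edge e pub) v i by rewrite VsE inE.
have Vspub : Vs \subset pub.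
  apply/fintype.subsetP => i; rewrite memVs => /closed_connect <- //.
  by move=> x y /and3P[-> ->].
have closed_Vs i j : i \in Vs -> j \in pub -> e i j -> j \in Vs.
  move=> iVs jpub eij; rewrite memVs.
  apply: (@connect_trans _ _ i); first by rewrite -memVs.
  by apply: connect1; apply/and3P; split=> //; exact: (fintype.subsetP Vspub).
split=> //.
  move=> i iVs; apply/setP => j; rewrite !inE induced_edgeE iVs.
  apply/andP/andP => [[eij jpub]|[_ /andP[jVs eij]]]; split=> //.
    by rewrite eij andbT (closed_Vs i).
  exact: (fintype.subsetP Vspub).
have path_Vs p i : i \in Vs -> path (induced_edge e pub) i p ->
    path (induced_edge e Vs) i p.
  elim: p i => //= j p IH i iVs /andP[/and3P[_ jpub eij] jp].
  have jVs := closed_Vs _ _ iVs jpub eij.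
  by rewrite IH // andbT; apply/and3P.
have vVs : v \in Vs by rewrite memVs connect0.
exists v => // i; rewrite memVs => /connectP[p pv ->]; apply/connectP.
by exists p => //; apply: path_Vs.
Qed.

(** The mass statement is both hypothesis and conclusion, so that it propagates by induction on [k]
    together with the recurrence. *)
Lemma sample_law_step (d : measure_display) (T : measurableType d)
    (R : realType) (P : probability T R) (n : nat) (e : rel 'I_n)
    (pub Vs : {set 'I_n}) (X : nat -> T -> 'I_n) (U : nat -> nat -> T -> 'I_n)
    (k : nat) :
  let E := induced_edge e Vs in
  designed_random_walk P e pub Vs X U ->
  (forall i, i \in Vs -> neighbors e i :&: pub = [set j | E i j]%SET) ->
  (forall i, i \in Vs -> (0 < #|E i|)%N) ->
  \sum_(i in Vs) pr P [set w | X k w = i] = 1 ->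
  \sum_(i in Vs) pr P [set w | X k.+1 w = i] = 1 /\
  forall j, j \in Vs ->
    pr P [set w | X k.+1 w = j] =
    \sum_(i | E i j) pr P [set w | X k w = i] / #|E i|%:R.
Proof.
move=> E walk nbrE deg mass.
have mX l : finite_rv (X l) by exact: walk_measurable_sample walk l.
set p' := fun j => pr P [set w | X k.+1 w = j].
set r := fun j => \sum_(i | E i j) pr P [set w | X k w = i] / #|E i|%:R.
have r_le j : r j <= p' j.
  rewrite /p' (_ : [set w | _] = [set w | predT (X k w) /\ X k.+1 w = j]).
    rewrite pr_total //; last exact: mX.
    rewrite [leRHS](bigID (fun i => E i j)) /=.
    rewrite -[leLHS]addr0 lerD ?sumr_ge0 //; last by move=> *; exact: pr_ge0.
    apply: ler_sum => i Eij; have /and3P[iVs jVs eij] := Eij.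
    have -> : #|E i| = #|neighbors e i :&: pub|.
      by rewrite nbrE //; apply: eq_card => l; rewrite [RHS]inE.
    by apply: pr_step_ge walk _; rewrite nbrE // inE.
  by apply/seteqP; split=> w // [].
(* After exchanging the sums, each [i] gives an equal share of its mass to each of its [#|E i|]
   neighbors, so no mass is lost. *)
have sum_r : \sum_(j in Vs) r j = 1.
  rewrite -mass (exchange_big_dep (mem Vs)) /=; last first.
    by move=> j i _ /and3P[].
  apply: eq_bigr => i iVs.
  rewrite (eq_bigl (mem (E i))); last first.
    by move=> j; rewrite /= andb_idl // => /and3P[].
  by rewrite sumr_const -[LHS]mulr_natr divfK // pnatr_eq0 -lt0n deg.
have sum_p' : \sum_(j in Vs) p' j <= 1.
  rewrite -(pr_sum1 P (mX k.+1)) [leRHS](bigID (mem Vs)) /= lerDl sumr_ge0 //.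
  by move=> *; exact: pr_ge0.
(* The differences [p' j - r j] are nonnegative with total at most 0, so each of them vanishes. *)
have p'E j : j \in Vs -> p' j = r j.
  move=> jVs; apply/eqP; rewrite eq_le r_le andbT -subr_le0.
  apply: le_trans (_ : \sum_(j in Vs) (p' j - r j) <= _); last first.
    by rewrite sumrB sum_r subr_le0.
  rewrite (bigD1 j) //= lerDl sumr_ge0 // => l _.
  by rewrite subr_ge0.
by split=> //; rewrite -sum_r; apply: eq_bigr.
Qed.

(** * Convergence of the vector of laws *)

Lemma cvg_rowvec (R : realType) (n : nat) (u : nat -> 'rV[R]_n) (l : 'rV[R]_n) :
  (forall i, u k 0 i @[k --> \oo] --> l 0 i) -> u k @[k --> \oo] --> l.
Proof.
move=> ul; apply/cvg_ballP => eps eps0.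
have : \forall k \near \oo, forall i, ball (l 0 i) eps (u k 0 i).
  by apply: filter_forall => i; have /cvg_ballP := ul i; apply.
by apply: filterS => k H; split=> // i j; rewrite (ord1 i).
Qed.

Theorem lemma3p1 (d : measure_display) (T : measurableType d) (R : realType)
    (P : probability T R) (n : nat) (e : rel 'I_n) (pub Vs : {set 'I_n})
    (X : nat -> T -> 'I_n) (U : nat -> nat -> T -> 'I_n)
    (e_sym : symmetric e) (e_connected : is_connected_graph e)
    (Vs_largest : largest_public_cluster e pub Vs)
    (Vs_nonbipartite : ~ bipartite_on e Vs)
    (walk : designed_random_walk P e pub Vs X U) :
  sample_law P X r @[r --> \oo] --> limit_law R e Vs.
Proof.
have [/public_cluster_connected[_ nbrE [v vVs conn]] _] := Vs_largest.
set E := induced_edge e Vs in nbrE conn.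
have Esym : symmetric E by move=> i j; rewrite /E !induced_edgeE e_sym andbCA.
have EVs i j : E i j -> j \in Vs by case/and3P.
have nonbip (c : 'I_n -> bool) : exists i j, E i j /\ c i = c j.
  apply: contrapT => nE; apply: Vs_nonbipartite; exists c => i j Eij.
  by apply/negP => /eqP cij; apply: nE; exists i, j.
(* A constant colouring yields some edge of the cluster. By connectivity every node of [Vs] then has
   a neighbor: the first step of a path to [a], or [b] at [a] itself. *)
have [a [b [Eab _]]] := nonbip (fun=> true).
have nbr i : i \in Vs -> exists j, E i j.
  move=> iVs; have aVs : a \in Vs by case/and3P: Eab.
  have : connect E i a.
    apply: connect_trans (conn _ aVs).
    by rewrite (sym_connect_sym Esym) conn.
  case/connectP=> -[_ /= ai|x p /= /andP[Eix _] _]; last by exists x.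
  by exists b; rewrite -ai.
have deg i : i \in Vs -> (0 < #|E i|)%N.
  by move=> /nbr[j Eij]; apply/card_gt0P; exists j.
have odd_v : exists k, has_walk E k.*2.+1 v v.
  by apply: odd_closed_walk => // i j /and3P[iVs _ _]; apply: conn.
have [K walkK] := uniform_walk_length Esym conn nbr odd_v.
have mass k : \sum_(i in Vs) pr P [set w | X k w = i] = 1.
  elim: k => [|k IH]; last by have [] := sample_law_step walk nbrE deg IH.
  rewrite -(pr_total_setT P (mem Vs)); last exact: walk_measurable_sample walk 0%N.
  rewrite (_ : [set w | _] = setT) /pr ?probability_setT //.
  by apply/seteqP; split=> // w _; exact: walk_seed walk w.
have degE i : i \in Vs -> public_degree e Vs i = #|E i|.
  by move=> iVs; apply: eq_card => j; rewrite !inE induced_edgeE iVs; case: (j \in Vs).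
apply: cvg_rowvec => i; rewrite /limit_law mxE.
under eq_cvg do rewrite mxE -/(pr _ _).
have [iVs|iVs] := boolP (i \in Vs).
  rewrite mulr1 degE // /total_public_degree (eq_bigr (fun i => #|E i|)) //.
  apply: (@reversible_chain_cvg R _ E Vs (fun k j => pr P [set w | X k w = j])
    K v) => //.
  - by move=> j jVs; apply: walkK.
  - by move=> k j _; apply: pr_ge0.
  - move=> k j jVs; have [_ ->] // := sample_law_step walk nbrE deg (mass k).
    by apply: eq_bigl => l; rewrite Esym.
(* Outside [Vs] the law is 0 at every time: [Vs] already carries mass 1, and the remaining terms are
   nonnegative with sum 0. *)
rewrite mulr0; apply: cvg_near_cst; apply: nearW => k.
have := pr_sum1 P (walk_measurable_sample walk k).
rewrite (bigID (mem Vs)) /= mass -[RHS]addr0 => /addrI /eqP.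
rewrite psumr_eq0; last by move=> j _; apply: pr_ge0.
by move=> /allP/(_ i (mem_index_enum i)); rewrite iVs => /eqP.
Qed.
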